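(* Let $\mathrm{Vir}=\mathbb{C}[\partial]L$ be the Virasoro Lie conformal algebra, with $[L_\lambda L]=(\partial+2\lambda)L$. Then: (1) $GDer(\mathrm{Vir})=QDer(\mathrm{Vir})=\{D_\lambda = a_0(\lambda)+a_1(\lambda)\partial \mid a_0(\lambda),a_1(\lambda)\in\mathbb{C}[\lambda]\}$, where $D_\lambda=a_0(\lambda)+a_1(\lambda)\partial$ denotes the conformal linear map determined by $D_\lambda(L)=(a_0(\lambda)+a_1(\lambda)\partial)L$. (2) $C(\mathrm{Vir})=QC(\mathrm{Vir})=0$.
   Context: Let $\mathcal{A}=\mathbb{C}[\partial]$. A Lie conformal algebra is an $\mathcal{A}$-module $R$ with a $\mathbb{C}$-bilinear map $R\otimes R\to R[\lambda]$, $a\otimes b\mapsto[a_\lambda b]$, such that for all $a,b,c\in R$: $[\partial a_\lambda b]=-\lambda[a_\lambda b]$, $[a_\lambda\partial b]=(\partial+\lambda)[a_\lambda b]$; $[a_\lambda b]=-[b_{-\lambda-\partial}a]$; $[a_\lambda[b_\mu c]]=[[a_\lambda b]_{\lambda+\mu}c]+[b_\mu[a_\lambda c]]$. $gc(R)=Cend(R)$ is the set of conformal linear maps from $R$ to $R$, i.e. $\mathbb{C}$-linear maps $D_\lambda:R\to R[\lambda]$ with $D_\lambda(\partial a)=(\partial+\lambda)D_\lambda(a)$ for all $a\in R$. Brackets such as $[(D_\lambda a)_{\lambda+\mu}b]$ are extended linearly over polynomials in the indeterminates. $QDer(R)$ (conformal quasiderivations): $D_\lambda\in gc(R)$ for which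 there is $D'_\lambda\in gc(R)$ with $[(D_\lambda a)_{\lambda+\mu}b]+[a_\mu(D_\lambda b)]=D'_\lambda([a_\mu b])$ for all $a,b\in R$. $GDer(R)$ (generalized conformal derivations): $D_\lambda\in gc(R)$ for which there are $D'_\lambda,D''_\lambda\in gc(R)$ with $[(D_\lambda a)_{\lambda+\mu}b]+[a_\mu(D'_\lambda b)]=D''_\lambda([a_\mu b])$ for all $a,b\in R$. $C(R)$ (conformal centroids): $D_\lambda\in gc(R)$ with $D_\lambda([a_\mu b])=[(D_\lambda a)_{\lambda+\mu}b]=[a_\mu(D_\lambda b)]$ for all $a,b\in R$. $QC(R)$ (conformal quasicentroids): $D_\lambda\in gc(R)$ with $[(D_\lambda a)_{\lambda+\mu}b]=[a_\mu(D_\lambda b)]$ for all $a,b\in R$. *)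

(* Defs.v *)
From HB Require Import structures.
From mathcomp Require Import all_boot all_order all_algebra.
From mathcomp Require Import finmap.
From mathcomp Require Import boolp classical_sets reals.
From mathcomp.multinomials Require Export monalg.
From mathcomp.real_closed Require Export complex.
From mathcomp Require Import ring.

Set Implicit Arguments.
Unset Strict Implicit.
Unset Printing Implicit Defensive.

Import GRing.Theory.
Local Open Scope fset_scope.
Local Open Scope ring_scope.

(* V[x]: polynomials in one indeterminate with coefficients in an A-module V.
   It is a module over A[x], whose indeterminate is the same x; iterating,
   V[lambda][mu] = vpoly (vpoly V) is a module over A[lambda][mu] =
   {poly {poly A}}. *)
Definition vpoly (A : comNzRingType) (V : lmodType A) : Type := {malg V[nat]}.

HB.instance Definition _ (A : comNzRingType) (V : lmodType A) :=
  GRing.Zmodule.on (vpoly V).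

Section VPoly.
Variables (A : comNzRingType) (V : lmodType A).
Implicit Types (p q : {poly A}) (g h : vpoly V).

Definition vmono (n : nat) (v : V) : vpoly V := << v *g n >>.

Definition vconst (v : V) : vpoly V := vmono 0 v.

Definition vfold (W : zmodType) (F : nat -> V -> W) g : W :=
  \sum_(n <- (msupp g : {fset nat})) F n g@_n.

Definition vscale p g : vpoly V :=
  \sum_(i < size p) vfold (fun n v => vmono (i + n) (p`_i *: v)) g.

Lemma vmonoD n : {morph vmono n : u v / u + v}.
Proof. exact: monalgUD. Qed.

Lemma vmono0 n : vmono n 0 = 0.
Proof. exact: monalgU0. Qed.

Lemma vpolyE g : g = vfold vmono g.
Proof. exact: monalgE. Qed.

Section Fold.
Variables (W : zmodType) (F : nat -> V -> W).
Hypothesis FD : forall n, {morph F n : u v / u + v}.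

Let F0 n : F n 0 = 0.
Proof. by apply: (addrI (F n 0)); rewrite -FD !addr0. Qed.

Lemma vfoldEw g (d : {fset nat}) : msupp g `<=` d ->
  vfold F g = \sum_(n <- d) F n g@_n.
Proof.
move=> le; rewrite /vfold; apply: big_fset_incl => // n _ nin.
by rewrite mcoeff_outdom // F0.
Qed.

Lemma vfoldD : {morph vfold F : g h / g + h}.
Proof.
move=> g h; rewrite (@vfoldEw (g + h) (msupp g `|` msupp h)); last exact: msuppD_le.
rewrite (@vfoldEw g (msupp g `|` msupp h)) ?fsubsetUl //.
rewrite (@vfoldEw h (msupp g `|` msupp h)) ?fsubsetUr //.
by rewrite -big_split; apply: eq_bigr => n _; rewrite mcoeffD FD.
Qed.

Lemma vfold_mono n v : vfold F (vmono n v) = F n v.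
Proof.
rewrite (@vfoldEw _ [fset n]); last exact: msuppU_le.
by rewrite big_seq_fset1 mcoeffUU.
Qed.

Lemma vfold0 : vfold F 0 = 0.
Proof. by rewrite /vfold msupp0 big_seq_fset0. Qed.

Lemma vfold_sum (I : Type) (r : seq I) (P : pred I) (G : I -> vpoly V) :
  vfold F (\sum_(i <- r | P i) G i) = \sum_(i <- r | P i) vfold F (G i).
Proof. exact: (big_morph _ vfoldD vfold0). Qed.
End Fold.

Lemma vscaleEw N p g : (size p <= N)%N ->
  vscale p g = \sum_(i < N) vfold (fun n v => vmono (i + n) (p`_i *: v)) g.
Proof.
move=> leN; rewrite /vscale.
rewrite (big_ord_widen N (fun i : nat =>
  vfold (fun n v => vmono (i + n) (p`_i *: v)) g)) // big_mkcond /=.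
apply: eq_bigr => i _; case: ltnP => // le_pi.
by rewrite /vfold big1 // => n _; rewrite nth_default // scale0r vmono0.
Qed.

Let foldD (i : nat) (c : A) : forall n, {morph (fun v => vmono (i + n) (c *: v)) : u v / u + v}.
Proof. by move=> n u v; rewrite scalerDr vmonoD. Qed.

Lemma vscaleDr p : {morph vscale p : g h / g + h}.
Proof.
by move=> g h; rewrite /vscale -big_split; apply: eq_bigr => i _; rewrite vfoldD.
Qed.

Lemma vscaleDl g : {morph (fun p => vscale p g) : p q / p + q}.
Proof.
move=> p q; set N := maxn (size p) (size q).
rewrite !(@vscaleEw N) ?leq_maxl ?leq_maxr //; last exact: size_polyD.
rewrite -big_split; apply: eq_bigr => i _; rewrite /vfold -big_split.
by apply: eq_bigr => n _; rewrite coefD scalerDl vmonoD.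
Qed.

Lemma vscale1 g : vscale 1 g = g.
Proof.
rewrite /vscale size_poly1 big_ord1 coef1 eqxx [RHS]vpolyE.
by apply: eq_bigr => n _; rewrite add0n scale1r.
Qed.

Lemma vscale_mono (c : A) i n v :
  vscale (c *: 'X^i) (vmono n v) = vmono (i + n) (c *: v).
Proof.
rewrite (@vscaleEw i.+1); last by rewrite (leq_trans (size_scale_leq _ _)) ?size_polyXn.
rewrite big_ord_recr /= vfold_mono // coefZ coefXn eqxx mulr1 big1 ?add0r // => j _.
by rewrite vfold_mono // coefZ coefXn ltn_eqF // mulr0 scale0r vmono0.
Qed.

Let vscale_suml (I : Type) (r : seq I) (P : pred I) (G : I -> {poly A}) g :
  vscale (\sum_(i <- r | P i) G i) g = \sum_(i <- r | P i) vscale (G i) g.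
Proof.
apply: (big_morph (vscale^~ g)); first exact: vscaleDl.
by rewrite /vscale size_poly0 big_ord0.
Qed.

Let vscale_sumr (I : Type) (r : seq I) (P : pred I) (G : I -> vpoly V) p :
  vscale p (\sum_(i <- r | P i) G i) = \sum_(i <- r | P i) vscale p (G i).
Proof.
apply: (big_morph (vscale p)); first exact: vscaleDr.
by rewrite /vscale big1 // => i _; rewrite vfold0.
Qed.

Lemma vscaleA p q g : vscale p (vscale q g) = vscale (p * q) g.
Proof.
have -> : g = \sum_(n <- (msupp g : {fset nat})) vmono n g@_n by exact: vpolyE.
rewrite !vscale_sumr; apply: eq_bigr => n _.
rewrite -[q]coefK poly_def vscale_suml vscale_sumr mulr_sumr vscale_suml.
apply: eq_bigr => j _; rewrite -[p]coefK poly_def mulr_suml !vscale_suml.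
apply: eq_bigr => i _; rewrite -scalerAl -scalerAr -exprD scalerA.
by rewrite !vscale_mono addnA scalerA.
Qed.

HB.instance Definition _ := GRing.Zmodule_isLmodule.Build {poly A} (vpoly V)
  vscaleA vscale1 vscaleDr (fun g p q => vscaleDl g p q).

Lemma vpoly_scale_mono (c : A) i n v :
  (c *: 'X^i) *: vmono n v = vmono (i + n) (c *: v).
Proof. exact: vscale_mono. Qed.

Lemma vmonoE n v : vmono n v = 'X^n *: vconst v.
Proof. by rewrite -['X^n]scale1r vpoly_scale_mono addn0 scale1r. Qed.

Lemma vconstZ (c : A) v : vconst (c *: v) = c%:P *: vconst v.
Proof.
rewrite -[c%:P]alg_polyC.
by have := vpoly_scale_mono c 0 0 v; rewrite expr0 => ->.
Qed.

Lemma vconstD : {morph vconst : u v / u + v}.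
Proof. exact: vmonoD. Qed.

(* The value at t of the polynomial whose coefficients are the images by f of
   those of g: the image of g under the map that extends f and sends the
   indeterminate to t. *)
Definition vsubst (S : comNzRingType) (W : lmodType S) (t : S) (f : V -> W) g : W :=
  \sum_(n <- (msupp g : {fset nat})) t ^+ n *: f g@_n.

Section Subst.
Variables (S : comNzRingType) (W : lmodType S) (t : S) (f : V -> W).
Hypothesis fD : {morph f : u v / u + v}.

Let FD n : {morph (fun v => t ^+ n *: f v) : u v / u + v}.
Proof. by move=> u v; rewrite fD scalerDr. Qed.

Lemma vsubstD : {morph vsubst t f : g h / g + h}.
Proof. exact: (vfoldD FD). Qed.

Lemma vsubst_mono n v : vsubst t f (vmono n v) = t ^+ n *: f v.
Proof. exact: (vfold_mono FD). Qed.

Lemma vsubst_const v : vsubst t f (vconst v) = f v.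
Proof. by rewrite vsubst_mono expr0 scale1r. Qed.

Lemma vsubst_sum (I : Type) (r : seq I) (P : pred I) (G : I -> vpoly V) :
  vsubst t f (\sum_(i <- r | P i) G i) = \sum_(i <- r | P i) vsubst t f (G i).
Proof. exact: (vfold_sum FD). Qed.

Lemma vsubstZ (phi : {rmorphism A -> S}) p g :
  (forall c v, f (c *: v) = phi c *: f v) ->
  vsubst t f (p *: g) = (map_poly phi p).[t] *: vsubst t f g.
Proof.
move=> fZ.
have -> : g = \sum_(n <- (msupp g : {fset nat})) vmono n g@_n by exact: vpolyE.
rewrite scaler_sumr !vsubst_sum scaler_sumr.
apply: eq_bigr => n _; rewrite -[p]coefK poly_def scaler_suml vsubst_sum.
rewrite rmorph_sum horner_sum scaler_suml; apply: eq_bigr => i _.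
rewrite vpoly_scale_mono !vsubst_mono fZ /= map_polyZ hornerZ map_polyXn hornerXn.
by rewrite !scalerA exprD; congr (_ *: _); ring.
Qed.
End Subst.

End VPoly.

Section Brackets.
Variables (K : fieldType) (R : lmodType {poly K}) (br : R -> R -> vpoly R).

(* [a_t b] in R[lambda], for t in C[d][lambda] *)
Definition bracket1 (t : {poly {poly K}}) (a b : R) : vpoly R :=
  vsubst t (@vconst _ R) (br a b).

(* [a_t b] in R[lambda][mu], for t in C[d][lambda][mu] *)
Definition bracket2 (t : {poly {poly {poly K}}}) (a b : R) : vpoly (vpoly R) :=
  vsubst t (fun c => vconst (vconst c)) (br a b).

End Brackets.

(* In {poly {poly K}}, the indeterminate d of {poly K} is 'X%:P and lambda is
   'X; in {poly {poly {poly K}}}, d is 'X%:P%:P, lambda is 'X%:P and mu is 'X. *)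
Local Notation lambda := ('X%:P) (only parsing).
Local Notation mu := ('X) (only parsing).

Record lieConformalAlgebra (K : fieldType) := LieConformalAlgebra {
  lca_sort :> lmodType {poly K};
  bracket : lca_sort -> lca_sort -> vpoly lca_sort;
  bracket_linearl : forall (k : K) a a' b,
    bracket (k%:P *: a + a') b = k%:P%:P *: bracket a b + bracket a' b;
  bracket_linearr : forall (k : K) a b b',
    bracket a (k%:P *: b + b') = k%:P%:P *: bracket a b + bracket a b';
  bracket_partiall : forall a b,
    bracket ('X *: a) b = (- 'X) *: bracket a b;
  bracket_partialr : forall a b,
    bracket a ('X *: b) = ('X%:P + 'X) *: bracket a b;
  bracket_skew : forall a b,
    bracket a b = - bracket1 bracket (- 'X - 'X%:P) b a;
  bracket_jacobi : forall a b c,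
    vsubst mu (fun d => bracket2 bracket lambda a d) (bracket b c)
    = vsubst lambda (fun d => bracket2 bracket (lambda + mu) d c) (bracket a b)
    + vsubst lambda (fun d => bracket2 bracket mu b d) (bracket a c)
}.

Arguments bracket {K l} a b.

Section ConformalMaps.
Local Open Scope classical_set_scope.
Variables (K : fieldType) (R : lieConformalAlgebra K).
Implicit Types (D : R -> vpoly R) (a b : R).

Definition gc : set (R -> vpoly R) := [set D |
  (forall (k : K) a b, D (k%:P *: a + b) = k%:P%:P *: D a + D b) /\
  (forall a, D ('X *: a) = ('X%:P + 'X) *: D a)].

(* [(D_lambda a)_{lambda+mu} b] *)
Definition bracketDl D a b : vpoly (vpoly R) :=
  vsubst lambda (fun c => bracket2 bracket (lambda + mu) c b) (D a).

(* [a_mu (D_lambda b)] *)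
Definition bracketDr D a b : vpoly (vpoly R) :=
  vsubst lambda (fun c => bracket2 bracket mu a c) (D b).

(* D_lambda([a_mu b]) *)
Definition mapbracket D a b : vpoly (vpoly R) :=
  vsubst mu (fun c => vsubst lambda (fun d => vconst (vconst d)) (D c)) (bracket a b).

Definition QDer : set (R -> vpoly R) := [set D | gc D /\
  exists2 D', gc D' &
    forall a b, bracketDl D a b + bracketDr D a b = mapbracket D' a b].

Definition GDer : set (R -> vpoly R) := [set D | gc D /\
  exists D' D'', [/\ gc D', gc D'' &
    forall a b, bracketDl D a b + bracketDr D' a b = mapbracket D'' a b]].

Definition centroid : set (R -> vpoly R) := [set D | gc D /\
  forall a b, mapbracket D a b = bracketDl D a b /\
              bracketDl D a b = bracketDr D a b].

Definition quasicentroid : set (R -> vpoly R) := [set D | gc D /\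
  forall a b, bracketDl D a b = bracketDr D a b].

End ConformalMaps.

Arguments gc {K} R.
Arguments QDer {K} R.
Arguments GDer {K} R.
Arguments centroid {K} R.
Arguments quasicentroid {K} R.

Section Virasoro.
Variable K : fieldType.

(* The free {poly K}-module of rank one, with generator Vir_L: p is p(d) L. *)
Definition Vir_module : lmodType {poly K} := {poly K}^o.

Definition Vir_L : Vir_module := 1.

Lemma Vir_gen (a : Vir_module) : a = (a : {poly K}) *: Vir_L.
Proof. by rewrite /GRing.scale /= mulr1. Qed.

(* p(t), for p in K[x] and t in K[d][lambda] *)
Definition eval2 (t : {poly {poly K}}) (p : {poly K}) : {poly {poly K}} :=
  (map_poly (polyC \o polyC) p).[t].

HB.instance Definition _ t := GRing.RMorphism.copy (eval2 t)
  (horner_eval t \o map_poly (polyC \o polyC)).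

(* p(t), for p in K[x] and t in K[d][lambda][mu] *)
Definition eval3 (t : {poly {poly {poly K}}}) (p : {poly K}) :
    {poly {poly {poly K}}} :=
  (map_poly (polyC \o (polyC \o polyC)) p).[t].

HB.instance Definition _ t := GRing.RMorphism.copy (eval3 t)
  (horner_eval t \o map_poly (polyC \o (polyC \o polyC))).

Lemma eval2C t c : eval2 t c%:P = c%:P%:P.
Proof. by rewrite /eval2 map_polyC hornerC. Qed.

Lemma eval2X t : eval2 t 'X = t.
Proof. by rewrite /eval2 map_polyX hornerX. Qed.

Lemma eval3C t c : eval3 t c%:P = c%:P%:P%:P.
Proof. by rewrite /eval3 map_polyC hornerC. Qed.

Lemma eval3X t : eval3 t 'X = t.
Proof. by rewrite /eval3 map_polyX hornerX. Qed.

Lemma eval3_partial p : eval3 'X%:P%:P p = p%:P%:P.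
Proof.
elim/poly_ind: p => [|p c IH]; first by rewrite rmorph0.
by rewrite !rmorphD !rmorphM /= IH eval3X eval3C.
Qed.

Definition eval23 (u s : {poly {poly {poly K}}}) (F : {poly {poly K}}) :=
  (map_poly (eval3 u) F).[s].

HB.instance Definition _ u s := GRing.RMorphism.copy (eval23 u s)
  (horner_eval s \o map_poly (eval3 u)).

Lemma eval2Z t (k : {poly K}) (a : Vir_module) :
  eval2 t (k *: a : Vir_module) = eval2 t k * eval2 t a.
Proof. exact: rmorphM. Qed.

Lemma eval3Z t (k : {poly K}) (a : Vir_module) :
  eval3 t (k *: a : Vir_module) = eval3 t k * eval3 t a.
Proof. exact: rmorphM. Qed.

Lemma eval23C u s c : eval23 u s c%:P = eval3 u c.
Proof. by rewrite /eval23 map_polyC hornerC. Qed.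

Lemma eval23X u s : eval23 u s 'X = s.
Proof. by rewrite /eval23 map_polyX hornerX. Qed.

Lemma eval23_eval2 u s w p : eval23 u s (eval2 w p) = eval3 (eval23 u s w) p.
Proof.
elim/poly_ind: p => [|p c IH]; first by rewrite !rmorph0.
by rewrite !rmorphD !rmorphM /= IH eval2X eval2C eval3X eval3C eval23C eval3C.
Qed.

Definition Vir_coef (p q : {poly K}) : {poly {poly K}} :=
  eval2 (- 'X) p * eval2 ('X%:P + 'X) q * ('X%:P + 2%:R * 'X).

(* [p(d)L _lambda q(d)L] = p(-lambda) q(d+lambda) (d + 2 lambda) L *)
Definition Vir_bracket (a b : Vir_module) : vpoly Vir_module :=
  Vir_coef a b *: vconst Vir_L.

Lemma eval23_Vir_coef u s p q : eval23 u s (Vir_coef p q) =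
  eval3 (- s) p * eval3 (u + s) q * (u + 2%:R * s).
Proof.
rewrite /Vir_coef !rmorphM /= !eval23_eval2 !rmorphD rmorphN !rmorphM /=.
by rewrite !eval23X !eval23C !eval3X rmorph_nat.
Qed.

Lemma Vir_bracketLL :
  Vir_bracket Vir_L Vir_L = ('X%:P + 2%:R * 'X) *: vconst Vir_L.
Proof. by rewrite /Vir_bracket /Vir_coef /Vir_L !rmorph1 !mul1r. Qed.

Fact Vir_linearl (k : K) (a a' b : Vir_module) :
  Vir_bracket (k%:P *: a + a') b =
  k%:P%:P *: Vir_bracket a b + Vir_bracket a' b.
Proof.
rewrite /Vir_bracket /Vir_coef scalerA -scalerDl rmorphD /= eval2Z eval2C.
by congr (_ *: _); ring.
Qed.

Fact Vir_linearr (k : K) (a b b' : Vir_module) :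
  Vir_bracket a (k%:P *: b + b') =
  k%:P%:P *: Vir_bracket a b + Vir_bracket a b'.
Proof.
rewrite /Vir_bracket /Vir_coef scalerA -scalerDl rmorphD /= eval2Z eval2C.
by congr (_ *: _); ring.
Qed.

Fact Vir_partiall (a b : Vir_module) :
  Vir_bracket ('X *: a) b = (- 'X) *: Vir_bracket a b.
Proof.
rewrite /Vir_bracket /Vir_coef scalerA eval2Z eval2X.
by congr (_ *: _); ring.
Qed.

Fact Vir_partialr (a b : Vir_module) :
  Vir_bracket a ('X *: b) = ('X%:P + 'X) *: Vir_bracket a b.
Proof.
rewrite /Vir_bracket /Vir_coef scalerA eval2Z eval2X.
by congr (_ *: _); ring.
Qed.

Lemma Vir_bracket1 t (a b : Vir_module) : bracket1 Vir_bracket t a b =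
  (eval2 (- t) a * eval2 ('X%:P + t) b * ('X%:P + 2%:R * t)) *: vconst Vir_L.
Proof.
have conj p (w : {poly {poly K}}) :
    (map_poly polyC (eval2 w p)).[t] = eval2 (map_poly polyC w).[t] p.
  elim/poly_ind: p => [|p c IH]; first by rewrite !rmorph0 horner0.
  rewrite !rmorphD !rmorphM /= hornerD hornerM IH !eval2X !eval2C.
  by rewrite map_polyC hornerC.
rewrite /bracket1 /Vir_bracket (vsubstZ _ (@vconstD _ _) _ _ (@vconstZ _ _)).
rewrite vsubst_const; last exact: vconstD.
congr (_ *: _); rewrite /Vir_coef !rmorphM /= !hornerM !conj.
by rewrite !(rmorphD, rmorphN, rmorphM, rmorph_nat) /=
  ?(map_polyX, map_polyC, hornerE).
Qed.

Fact Vir_skew (a b : Vir_module) :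
  Vir_bracket a b = - bracket1 Vir_bracket (- 'X - 'X%:P) b a.
Proof.
rewrite Vir_bracket1 -scaleNr; congr (_ *: _); rewrite /Vir_coef.
have -> : - (- 'X - 'X%:P) = 'X%:P + 'X :> {poly {poly K}} by ring.
have -> : 'X%:P + (- 'X - 'X%:P) = - 'X :> {poly {poly K}} by ring.
by ring.
Qed.

Let vc2D : {morph (fun c : Vir_module => vconst (vconst c)) : u v / u + v}.
Proof. by move=> u v; rewrite !vconstD. Qed.

Lemma Vir_bracket2 t (a b : Vir_module) : bracket2 Vir_bracket t a b =
  (eval3 (- t) a * eval3 ('X%:P%:P + t) b * ('X%:P%:P + 2%:R * t))
    *: vconst (vconst Vir_L).
Proof.
rewrite /bracket2 /Vir_bracket (vsubstZ _ vc2D (phi := eval3 'X%:P%:P)).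
  by rewrite vsubst_const // -/(eval23 _ _ _) eval23_Vir_coef.
by move=> c v; rewrite !vconstZ /= eval3_partial.
Qed.

Fact Vir_jacobi (a b c : Vir_module) :
  vsubst mu (fun d => bracket2 Vir_bracket lambda a d) (Vir_bracket b c)
  = vsubst lambda (fun d => bracket2 Vir_bracket (lambda + mu) d c) (Vir_bracket a b)
  + vsubst lambda (fun d => bracket2 Vir_bracket mu b d) (Vir_bracket a c).
Proof.
have Dl t e : {morph (fun d => bracket2 Vir_bracket t d e) : u v / u + v}.
  by move=> u v; rewrite !Vir_bracket2 -scalerDl rmorphD; congr (_ *: _); ring.
have Dr t e : {morph (fun d => bracket2 Vir_bracket t e d) : u v / u + v}.
  by move=> u v; rewrite !Vir_bracket2 -scalerDl rmorphD; congr (_ *: _); ring.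
have Zl t e k v : bracket2 Vir_bracket t (k *: v) e =
    eval3 (- t) k *: bracket2 Vir_bracket t v e.
  by rewrite !Vir_bracket2 scalerA eval3Z !mulrA.
have Zr t e k v : bracket2 Vir_bracket t e (k *: v) =
    eval3 ('X%:P%:P + t) k *: bracket2 Vir_bracket t e v.
  rewrite !Vir_bracket2 scalerA eval3Z.
  by congr (_ *: _); ring.
have Sl s t e F :
    vsubst s (fun d => bracket2 Vir_bracket t d e) (F *: vconst Vir_L) =
    eval23 (- t) s F *: bracket2 Vir_bracket t Vir_L e.
  have := vsubstZ s (Dl t e) F (vconst Vir_L) (fun k v => Zl t e k v).
  by rewrite (vsubst_const s (Dl t e)).
have Sr s t e F :
    vsubst s (fun d => bracket2 Vir_bracket t e d) (F *: vconst Vir_L) =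
    eval23 ('X%:P%:P + t) s F *: bracket2 Vir_bracket t e Vir_L.
  have := vsubstZ s (Dr t e) F (vconst Vir_L) (fun k v => Zr t e k v).
  by rewrite (vsubst_const s (Dr t e)).
have E3 (x y z x' y' z' : vpoly (vpoly Vir_module)) :
  x = x' -> y = y' -> z = z' -> x' = y' + z' -> x = y + z by move=> -> -> ->.
apply: (E3 _ _ _ _ _ _ (Sr _ _ _ _) (Sl _ _ _ _) (Sr _ _ _ _)).
rewrite !eval23_Vir_coef !Vir_bracket2 !scalerA -scalerDl.
rewrite /Vir_L !rmorph1; congr (_ *: _).
have -> : 'X%:P%:P + 'X%:P + 'X = 'X%:P%:P + ('X%:P + 'X) :> {poly {poly {poly K}}} by ring.
have -> : 'X%:P%:P + 'X + 'X%:P = 'X%:P%:P + ('X%:P + 'X) :> {poly {poly {poly K}}} by ring.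
have -> : - ('X%:P + 'X) + 'X%:P = - 'X :> {poly {poly {poly K}}} by ring.
by ring.
Qed.

Definition Vir : lieConformalAlgebra K := LieConformalAlgebra
  Vir_linearl Vir_linearr Vir_partiall Vir_partialr Vir_skew Vir_jacobi.

Lemma gc_Vir_determined (F : {poly {poly K}}) :
  exists! D : Vir -> vpoly Vir, gc Vir D /\ D Vir_L = F *: vconst Vir_L.
Proof.
exists (fun p : Vir => (eval2 ('X%:P + 'X) p * F) *: vconst Vir_L).
split=> [|D [[Dlin Dpart] DL]].
  split; last by rewrite /Vir_L rmorph1 mul1r.
  split=> [k a b|a].
    rewrite scalerA -scalerDl rmorphD mulrDl /= eval2Z.
    by rewrite eval2C mulrA.
  by rewrite scalerA eval2Z eval2X mulrA.
have D0 : D 0 = 0.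
  by rewrite -[X in D X](addr0 0) -[X in D (X + _)](scaler0 _ ((-1)%:P : {poly K})) Dlin !polyCN !scaleN1r addNr.
apply: funext => p; elim/poly_ind: p => [|p c IH].
  by rewrite rmorph0 mul0r scale0r D0.
have -> : p * 'X + c%:P = c%:P *: Vir_L + ('X : {poly K}) *: (p : Vir_module).
  by rewrite -[c%:P *: _]Vir_gen addrC mulrC.
rewrite Dlin Dpart -IH DL !scalerA -scalerDl; congr (_ *: _).
by rewrite rmorphD /= !eval2Z eval2C eval2X /Vir_L rmorph1 mulr1; ring.
Qed.

End Virasoro.

(* Main.v *)
Require Import Defs.
From mathcomp Require Import all_boot all_order all_algebra.
From mathcomp Require Import boolp classical_sets reals.
From mathcomp Require Import polyXY ring.

Import GRing.Theory.
Local Open Scope ring_scope.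
Local Open Scope complex_scope.
Local Open Scope classical_set_scope.

(** The symbol of a conformal linear map D of Vir is the polynomial F(d, lambda)
with D_lambda(L) = F(d, lambda) L, where d stands for the derivation; it may be
any polynomial and it determines D.  Sesquilinearity turns each of
[(D_lambda a)_{lambda+mu} b], [a_mu (D_lambda b)] and D_lambda([a_mu b]), for
a = p(d) L and b = q(d) L, into the common factor p(-mu) q(d+lambda+mu) times
the value at a = b = L (bracketDlE, bracketDrE, mapbracketE).  The defining
identity of a generalized derivation with symbols F, G, H is therefore one
identity of polynomials in d, lambda, mu (gder_symbolP):

  F(-lambda-mu) (d+2 lambda+2 mu) + G(d+mu) (d+2 mu) = (d+lambda+2 mu) H(d),

the argument lambda of F, G and H being understood.  In the variables
x = d + mu and y = - lambda - mu it reads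

  F(y) (x-y+lambda) + G(x) (x-y-lambda) = (x-y) H(x+y+lambda).

Putting x = y gives lambda (F(x) - G(x)) = 0, so F = G (gder_symbol_eq).  The
right side depends on (x, y) through x - y and x + y only, so H can be
eliminated by comparing the points (x, 2x) and (3x, 0).  If F has degree n in d
with leading coefficient c(lambda) and n > 1, the coefficient of x^(n+1) in the
result is 3 (3^n - 2^n - 1) c(lambda), which cannot vanish in characteristic 0;
so n is at most 1 (gder_symbol_size).  Conversely F = G = a0 + a1 d satisfies
the identity with H = 2 a0 + a1 (d - 2 lambda) (affine_gder_symbol).  Since QDer
lies in GDer, this proves the first part.

A quasicentroid with symbol F satisfies the same identity with G = - F and
H = 0.  Then F = - F, so F = 0 and the quasicentroid vanishes; as the zero map
is a centroid, and centroids are quasicentroids, the second part follows. *)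

(** * Arithmetic and polynomials *)

Lemma coef_comp_polyCX (A : comNzRingType) (c : A) (p : {poly A}) n :
  (p \Po (c%:P * 'X))`_n = c ^+ n * p`_n.
Proof.
elim/poly_ind: p n => [|p d IH] n; first by rewrite rmorph0 coef0 mulr0.
rewrite comp_poly_MXaddC mulrCA !coefD coefCM !coefMX !coefC.
case: n => [|n] /=; first by rewrite mulr0 !add0r expr0 mul1r.
by rewrite IH !addr0 exprS mulrA.
Qed.

(** The growth comparison that excludes symbols of degree at least 2 in d. *)
Lemma expn3_gt n : (1 < n -> 1 + 2 ^ n < 3 ^ n)%N.
Proof.
elim: n => // -[//|[_ _|n IH _]]; first by [].
have {}IH := IH isT.
rewrite ![(_ ^ n.+3)%N]expnS.
apply: (@leq_ltn_trans (3 * (1 + 2 ^ n.+2))); last by rewrite ltn_pmul2l.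
by rewrite mulnDr leq_add // leq_mul2r orbT.
Qed.

(** * Inclusions valid in every Lie conformal algebra *)

Lemma QDer_sub_GDer (K : fieldType) (A : lieConformalAlgebra K) : QDer A `<=` GDer A.
Proof. by move=> D [gD [D' gD' eqD]]; split=> //; exists D, D'. Qed.

Lemma centroid_sub_quasicentroid (K : fieldType) (A : lieConformalAlgebra K) :
  centroid A `<=` quasicentroid A.
Proof.
by move=> D [gD eqD]; split; [exact: gD | move=> a b; exact: (eqD a b).2].
Qed.

Lemma gc0 (K : fieldType) (A : lieConformalAlgebra K) : gc A (fun=> 0).
Proof. by split=> [k a b|a]; rewrite !scaler0 ?addr0. Qed.

(** * Coordinates in a module of polynomials *)

Section ExtendForm.
Variables (A : comNzRingType) (V : lmodType A) (f : V -> A).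
Hypothesis fD : {morph f : u v / u + v}.
Hypothesis fZ : forall c v, f (c *: v) = c * f v.

(** Forms extend from V to V[x] in such a way that the construction can be
iterated; this is how coordinates in Vir[lambda][mu] arise. *)
Definition vform (g : vpoly V) : {poly A} :=
  vsubst (W := {poly A}^o) 'X (fun v => (f v)%:P) g.

Let cD : {morph (fun v => (f v)%:P : {poly A}^o) : u v / u + v}.
Proof. by move=> u v; rewrite fD polyCD. Qed.

Lemma vformD : {morph vform : g h / g + h}.
Proof. exact: (vsubstD 'X cD). Qed.

Lemma vform_const v : vform (vconst v) = (f v)%:P.
Proof. exact: (vsubst_const 'X cD). Qed.

Lemma vformZ p g : vform (p *: g) = p * vform g.
Proof.
have cZ c v : (f (c *: v))%:P = c%:P *: ((f v)%:P : {poly A}^o).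
  by rewrite fZ polyCM.
by have := vsubstZ 'X cD p g cZ; rewrite -/(comp_poly _ _) comp_polyXr.
Qed.

End ExtendForm.

(** * Symbols of conformal linear maps of Vir *)

Section Virasoro.
Variable K : fieldType.
Local Notation partial := ('X%:P%:P : {poly {poly {poly K}}}) (only parsing).
Local Notation lambda := ('X%:P : {poly {poly {poly K}}}) (only parsing).
Local Notation mu := ('X : {poly {poly {poly K}}}) (only parsing).
Implicit Types (F G H : {poly {poly K}}) (a b : Vir K).

Definition Vir_E : vpoly (vpoly (Vir_module K)) := vconst (vconst (Vir_L K)).

Definition vcoord : vpoly (Vir_module K) -> {poly {poly K}} :=
  vform _ (Vir_module K) (fun p => p).

Definition vcoord2 : vpoly (vpoly (Vir_module K)) -> {poly {poly {poly K}}} :=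
  vform _ (vpoly (Vir_module K)) vcoord.

Lemma vcoordD : {morph vcoord : g h / g + h}.
Proof. exact: vformD. Qed.

Lemma vcoordZ F g : vcoord (F *: g) = F * vcoord g.
Proof. exact: vformZ. Qed.

Lemma vcoord2_E (P : {poly {poly {poly K}}}) : vcoord2 (P *: Vir_E) = P.
Proof.
rewrite /vcoord2 (vformZ _ _ _ vcoordD vcoordZ) (vform_const _ _ _ vcoordD).
have -> : vcoord (vconst (Vir_L K)) = 1 by exact: vform_const.
by rewrite mulr1.
Qed.

(** Identities of multiples of L in Vir[lambda][mu] are identities of
polynomials. *)
Lemma Vir_E_inj (P Q : {poly {poly {poly K}}}) : P *: Vir_E = Q *: Vir_E -> P = Q.
Proof. by move=> /(congr1 vcoord2); rewrite !vcoord2_E. Qed.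

(** As L generates Vir freely, every conformal linear map has a symbol, namely
vcoord of its value at L. *)
Lemma vpoly_rank1 (g : vpoly (Vir_module K)) : g = vcoord g *: vconst (Vir_L K).
Proof.
rewrite {1}[g]vpolyE /vfold /vcoord /vsubst scaler_suml; apply: eq_bigr => n _.
by rewrite vmonoE {1}(Vir_gen g@_n) vconstZ scalerA.
Qed.

Lemma gc_VirE (D : Vir K -> vpoly (Vir K)) F : gc (Vir K) D ->
  D (Vir_L K) = F *: vconst (Vir_L K) ->
  forall a, D a = (eval2 ('X%:P + 'X) a * F) *: vconst (Vir_L K).
Proof.
move=> gcD DL.
set D' := fun a : Vir K => (eval2 ('X%:P + 'X) a * F) *: vconst (Vir_L K).
have [D0 [_ uniq]] := gc_Vir_determined F.
have <- : D0 = D by apply: uniq.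
suff -> : D0 = D' by [].
apply: uniq; split; last by rewrite /D' /Vir_L rmorph1 mul1r.
split=> [k a b|a].
  by rewrite /D' scalerA -scalerDl rmorphD mulrDl /= eval2Z eval2C mulrA.
by rewrite /D' scalerA eval2Z eval2X mulrA.
Qed.

Lemma eval23N u s F : eval23 u s (- F) = - eval23 u s F.
Proof. by rewrite /eval23 [map_poly _ _]rmorphN hornerN. Qed.

Lemma eval23_0 u s : eval23 u s 0 = 0 :> {poly {poly {poly K}}}.
Proof. by rewrite /eval23 map_poly0 horner0. Qed.

(** The factor by which sesquilinearity reduces p(d) L and q(d) L to L and L.
It is the same for the two brackets and for the image of the bracket, which is
why only the values at L matter. *)
Definition weight (a b : {poly K}) : {poly {poly {poly K}}} :=
  eval3 (- mu) a * eval3 (partial + lambda + mu) b.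

Section Symbol.
Variables (D : Vir K -> vpoly (Vir K)) (F : {poly {poly K}}).
Hypotheses (gcD : gc (Vir K) D) (DL : D (Vir_L K) = F *: vconst (Vir_L K)).

(** In the next three lemmas the outer map is additive and semilinear along an
evaluation morphism, so it is known once it is known on L; and L occurs in
[D a] multiplied by a(d + lambda) F. *)
Lemma bracketDlE a b : bracketDl D a b =
  (weight a b * (eval23 (- (lambda + mu)) lambda F *
     (partial + 2%:R * (lambda + mu)))) *: Vir_E.
Proof.
have Dl t e : {morph (fun d : Vir_module K => bracket2 (@Vir_bracket K) t d e) : u v / u + v}.
  by move=> u v; rewrite !Vir_bracket2 -scalerDl rmorphD; congr (_ *: _); ring.
have Zl t e k (v : Vir_module K) : bracket2 (@Vir_bracket K) t (k *: v) e =
    eval3 (- t) k *: bracket2 (@Vir_bracket K) t v e.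
  by rewrite !Vir_bracket2 scalerA eval3Z !mulrA.
rewrite /bracketDl (gc_VirE _ _ gcD DL).
rewrite (vsubstZ _ (Dl _ _) _ _ (phi := eval3 (- (lambda + mu))));
  last by move=> c v; exact: Zl.
rewrite (vsubst_const _ (Dl _ _)) -/(eval23 _ _ _) Vir_bracket2 scalerA.
congr (_ *: _); rewrite rmorphM /= eval23_eval2 rmorphD /= eval23X eval23C eval3X.
rewrite /Vir_L rmorph1 /weight addrA.
have -> : - ('X%:P + 'X) + 'X%:P = - 'X :> {poly {poly {poly K}}} by ring.
by ring.
Qed.

Lemma bracketDrE a b : bracketDr D a b =
  (weight a b * (eval23 (partial + mu) lambda F * (partial + 2%:R * mu))) *: Vir_E.
Proof.
have Dr t e : {morph (fun d : Vir_module K => bracket2 (@Vir_bracket K) t e d) : u v / u + v}.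
  by move=> u v; rewrite !Vir_bracket2 -scalerDl rmorphD; congr (_ *: _); ring.
have Zr t e k (v : Vir_module K) : bracket2 (@Vir_bracket K) t e (k *: v) =
    eval3 ('X%:P%:P + t) k *: bracket2 (@Vir_bracket K) t e v.
  by rewrite !Vir_bracket2 scalerA eval3Z; congr (_ *: _); ring.
rewrite /bracketDr (gc_VirE _ _ gcD DL).
rewrite (vsubstZ _ (Dr _ _) _ _ (phi := eval3 (partial + mu))); last by move=> c v; exact: Zr.
rewrite (vsubst_const _ (Dr _ _)) -/(eval23 _ _ _) Vir_bracket2 scalerA.
congr (_ *: _); rewrite rmorphM /= eval23_eval2 rmorphD /= eval23X eval23C eval3X.
rewrite /Vir_L rmorph1 /weight addrAC.
by ring.
Qed.

Lemma mapbracketE a b : mapbracket D a b =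
  (weight a b * ((partial + lambda + 2%:R * mu) * eval23 partial lambda F)) *: Vir_E.
Proof.
have vc2D : {morph (fun c : Vir_module K => vconst (vconst c)) : u v / u + v}.
  by move=> u v; rewrite !vconstD.
have inner (c : Vir_module K) :
    vsubst lambda (fun d : Vir_module K => vconst (vconst d)) (D c) =
    (eval3 (partial + lambda) c * eval23 partial lambda F) *: Vir_E.
  rewrite (gc_VirE _ _ gcD DL) (vsubstZ _ vc2D _ _ (phi := eval3 partial)).
    rewrite vsubst_const // -/(eval23 _ _ _) rmorphM /= eval23_eval2.
    by rewrite rmorphD /= eval23X eval23C eval3X.
  by move=> c' v; rewrite !vconstZ /= eval3_partial.
pose f (c : Vir_module K) := (eval3 (partial + lambda) c * eval23 partial lambda F) *: Vir_E.
have fD : {morph f : u v / u + v}.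
  by move=> u v; rewrite /f rmorphD mulrDl scalerDl.
have fZ k (v : Vir_module K) : f (k *: v) = eval3 (partial + lambda) k *: f v.
  by rewrite /f eval3Z scalerA mulrA.
have -> : mapbracket D a b = vsubst mu f (Vir_coef a b *: vconst (Vir_L K)).
  have -> : f = fun c : Vir_module K =>
      vsubst lambda (fun d : Vir_module K => vconst (vconst d)) (D c).
    by apply: funext => c; rewrite inner.
  by [].
rewrite (vsubstZ _ fD _ _ fZ) (vsubst_const _ fD) -/(eval23 _ _ _).
rewrite eval23_Vir_coef /f scalerA /Vir_L rmorph1 /weight.
by congr (_ *: _); ring.
Qed.
End Symbol.

Lemma weightLL : weight (Vir_L K) (Vir_L K) = 1.
Proof. by rewrite /weight /Vir_L !rmorph1 mulr1. Qed.

(** * The functional equation for symbols *)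

Definition gder_symbol F G H : Prop :=
  eval23 (- (lambda + mu)) lambda F * (partial + 2%:R * (lambda + mu))
  + eval23 (partial + mu) lambda G * (partial + 2%:R * mu)
  = (partial + lambda + 2%:R * mu) * eval23 partial lambda H.

Lemma gder_symbolP (D D' D'' : Vir K -> vpoly (Vir K)) F G H :
  gc (Vir K) D -> D (Vir_L K) = F *: vconst (Vir_L K) ->
  gc (Vir K) D' -> D' (Vir_L K) = G *: vconst (Vir_L K) ->
  gc (Vir K) D'' -> D'' (Vir_L K) = H *: vconst (Vir_L K) ->
  (forall a b, bracketDl D a b + bracketDr D' a b = mapbracket D'' a b) <->
  gder_symbol F G H.
Proof.
move=> gD DL gD' DL' gD'' DL''; split=> [/(_ (Vir_L K) (Vir_L K))|sym a b].
  rewrite (bracketDlE _ _ gD DL) (bracketDrE _ _ gD' DL').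
  by rewrite (mapbracketE _ _ gD'' DL'') -scalerDl weightLL !mul1r => /Vir_E_inj.
rewrite (bracketDlE _ _ gD DL) (bracketDrE _ _ gD' DL').
by rewrite (mapbracketE _ _ gD'' DL'') -scalerDl -mulrDr sym.
Qed.

(** After a change of variables that keeps lambda, a symbol is best read as a
polynomial in d over K[lambda], which is what swapXY does: its values then are
compositions of polynomials over K[lambda]. *)
Lemma eval23_swapXY (theta : {rmorphism {poly {poly {poly K}}} -> {poly {poly K}}})
    (u : {poly {poly {poly K}}}) F :
  (forall c : K, theta c%:P%:P%:P = c%:P%:P) -> theta 'X%:P = 'X%:P ->
  theta (eval23 u 'X%:P F) = swapXY F \Po theta u.
Proof.
move=> thC thl.
have th3 (p : {poly K}) : theta (eval3 u p) = (p^:P) \Po theta u.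
  elim/poly_ind: p => [|p c IH]; first by rewrite !rmorph0.
  rewrite !rmorphD !rmorphM /= IH eval3X eval3C thC.
  by rewrite map_polyX map_polyC comp_polyX comp_polyC.
elim/poly_ind: F => [|F c IH]; first by rewrite !rmorph0.
rewrite !rmorphD !rmorphM /= IH eval23X eval23C thl th3.
by rewrite swapXY_X swapXY_polyC comp_polyC.
Qed.

(** The substitution d = x + y + lambda, mu = - lambda - y, which gives
d + mu = x and - lambda - mu = y, so that F and G each depend on one of the
points x and y. *)
Lemma gder_symbol_subst F G H (x y : {poly {poly K}}) :
  gder_symbol F G H ->
  (swapXY F \Po y) * (x - y + 'X%:P) + (swapXY G \Po x) * (x - y - 'X%:P)
  = (x - y) * (swapXY H \Po (x + y + 'X%:P)).
Proof.
(* th1, th2, th3 extend the substitution to K[d], K[d][lambda] and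
   K[d][lambda][mu]. *)
pose th1 : {rmorphism {poly K} -> {poly {poly K}}} := eval2 (x + y + 'X%:P).
pose th2 : {rmorphism {poly {poly K}} -> {poly {poly K}}} :=
  horner_eval 'X%:P \o map_poly th1.
pose th3 : {rmorphism {poly {poly {poly K}}} -> {poly {poly K}}} :=
  horner_eval (- 'X%:P - y) \o map_poly th2.
have th1X : th1 'X = x + y + 'X%:P by exact: eval2X.
have th2C p : th2 p%:P = th1 p by rewrite /= map_polyC /horner_eval hornerC.
have th2X : th2 'X = 'X%:P by rewrite /= map_polyX /horner_eval hornerX.
have th3C p : th3 p%:P = th2 p by rewrite /= map_polyC /horner_eval hornerC.
have th3X : th3 'X = - 'X%:P - y by rewrite /= map_polyX /horner_eval hornerX.
have thK (c : K) : th3 c%:P%:P%:P = c%:P%:P by rewrite th3C th2C; exact: eval2C.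
clearbody th3; clearbody th2; clearbody th1.
have thl : th3 'X%:P = 'X%:P by rewrite th3C.
have thd : th3 'X%:P%:P = x + y + 'X%:P by rewrite th3C th2C.
move=> /(congr1 th3).
have th_2 : th3 2%:R = 2%:R by exact: rmorph_nat.
rewrite (rmorphD th3) !(rmorphM th3) !(eval23_swapXY _ _ _ thK thl).
rewrite !(th_2, thl, thd, th3X, rmorphD th3, rmorphN th3, rmorphM th3).
have -> : - ('X%:P + (- 'X%:P - y)) = y by ring.
have -> : x + y + 'X%:P + (- 'X%:P - y) = x by ring.
have -> : x + y + 'X%:P + 2%:R * ('X%:P + (- 'X%:P - y)) = x - y + 'X%:P by ring.
have -> : x + y + 'X%:P + 2%:R * (- 'X%:P - y) = x - y - 'X%:P by ring.
by have -> : x + y + 'X%:P + 'X%:P + 2%:R * (- 'X%:P - y) = x - y by ring.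
Qed.

(** On the diagonal x = y the term of H vanishes. *)
Lemma gder_symbol_eq F G H : gder_symbol F G H -> F = G.
Proof.
move=> /(gder_symbol_subst _ _ _ 'X 'X).
rewrite subrr mul0r add0r sub0r !comp_polyXr mulrN -mulrBl => /eqP.
rewrite mulf_eq0 polyC_eq0 polyX_eq0 orbF subr_eq0 => /eqP /(congr1 swapXY).
by rewrite !swapXYK.
Qed.

Hypothesis charK : [pchar K] =i pred0.

(** The points (x, 2x) and (3x, 0) have the same sum, so they involve the same
value h3 of H, with factors - x and 3x; three times the first equation plus the
second is free of H. *)
Lemma gder_symbol_size F G H : gder_symbol F G H -> (size (swapXY F) <= 2)%N.
Proof.
move=> sym; have eqFG := gder_symbol_eq _ _ _ sym; subst G.
have eqB := gder_symbol_subst _ _ _ 'X (2%:R%:P * 'X) sym.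
have eqC := gder_symbol_subst _ _ _ (3%:R%:P * 'X) 0 sym.
set f := swapXY F in eqB eqC *; set h := swapXY H in eqB eqC.
rewrite addr0 subr0 comp_poly0r in eqC.
rewrite comp_polyXr in eqB.
have e3 : 'X + 2%:R%:P * 'X = 3%:R%:P * 'X :> {poly {poly K}} by rewrite !polyC_natr; ring.
rewrite e3 in eqB.
set h3 := h \Po _ in eqB eqC.
set f2 := f \Po (2%:R%:P * 'X) in eqB; set f3 := f \Po (3%:R%:P * 'X) in eqC.
have key : (3%:R * f3 - 3%:R * f2 - 3%:R * f + 3%:R * (f`_0)%:P) * 'X
   + (3%:R * f2 - 3%:R * f - f3 + (f`_0)%:P) * 'X%:P = 0.
  have := congr2 (fun u v => 3%:R * u + v) eqB eqC.
  rewrite /= !polyC_natr => eqs.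
  transitivity (3%:R * ('X - 2%:R * 'X) * h3 + 3%:R * 'X * h3 : {poly {poly K}}); last by ring.
  by rewrite -mulrA -eqs; ring.
rewrite leqNgt; apply/negP => size_f.
case sz: (size f) size_f => [|[|[|n]]] // _.
(* n.+2 is the degree of f; the terms with factor lambda only meet f`_n.+3. *)
have fn : f`_n.+3 = 0 by rewrite nth_default // sz.
have := congr1 (fun p : {poly {poly K}} => p`_n.+3) key.
rewrite coef0 /= coefD coefMX coefMC !coefD !coefN -!polyC_natr !coefCM !coefC /=.
rewrite !coef_comp_polyCX fn => coef_key.
have /eqP : 3%:R * (3%:R ^+ n.+2 - (1 + 2%:R ^+ n.+2)) * f`_n.+2 = 0.
  by rewrite -[RHS]coef_key; ring.
have -> : 3%:R * (3%:R ^+ n.+2 - (1 + 2%:R ^+ n.+2)) =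
   (3 * (3 ^ n.+2 - (1 + 2 ^ n.+2)))%:R :> {poly K}.
  by rewrite natrM natrB ?(ltnW (expn3_gt _ _)) // natrD !natrX.
rewrite mulf_eq0 -polyC_natr polyC_eq0 ((pcharf0P K).1 charK) muln_eq0 subn_eq0.
rewrite leqNgt expn3_gt //= => /eqP lead0.
have : lead_coef f = 0 by rewrite lead_coefE sz.
by move=> /eqP; rewrite lead_coef_eq0 -size_poly_eq0 sz.
Qed.

Definition affine (a0 a1 : {poly K}) : {poly {poly K}} := a0^:P + a1^:P * 'X%:P.

Lemma gder_symbol_affine F G H : gder_symbol F G H ->
  exists a0 a1 : {poly K}, F = affine a0 a1.
Proof.
move=> /gder_symbol_size sz; exists (swapXY F)`_0, (swapXY F)`_1.
rewrite /affine -!swapXY_polyC -swapXY_X -rmorphM -rmorphD /=.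
apply: (can_inj (@swapXYK K)); rewrite swapXYK.
apply/polyP => i; rewrite coefD coefC coefMX coefC.
case: i => [|[|i]] /=; rewrite ?addr0 ?add0r //.
by rewrite nth_default // (leq_trans sz).
Qed.

Lemma eval23_affine u (a0 a1 : {poly K}) :
  eval23 u lambda (affine a0 a1) = eval3 lambda a0 + eval3 lambda a1 * u.
Proof.
(* A polynomial in lambda alone is an evaluation at lambda. *)
have mapE (p : {poly K}) : p^:P = eval2 'X p.
  elim/poly_ind: p => [|p c IH]; first by rewrite !rmorph0.
  by rewrite !rmorphD !rmorphM /= IH map_polyX map_polyC eval2X eval2C.
rewrite /affine !mapE rmorphD rmorphM /=.
by rewrite !eval23_eval2 eval23X eval23C eval3X.
Qed.

(** The third symbol is 2 a0 + a1 (d - 2 lambda), again affine in d. *)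
Lemma affine_gder_symbol (a0 a1 : {poly K}) :
  gder_symbol (affine a0 a1) (affine a0 a1)
    (affine (a0 + a0 - ('X + 'X) * a1) a1).
Proof.
have e3H : eval3 lambda (a0 + a0 - ('X + 'X) * a1) =
    eval3 lambda a0 + eval3 lambda a0 - (lambda + lambda) * eval3 lambda a1.
  pose e : {rmorphism {poly K} -> {poly {poly {poly K}}}} := eval3 lambda.
  have eX : e 'X = lambda by exact: eval3X.
  by rewrite -/(e _) (rmorphB e) (rmorphM e) !(rmorphD e) eX.
rewrite /gder_symbol !eval23_affine e3H.
by ring.
Qed.

(** * Derivations and centroids of Vir *)

Lemma GDer_Vir_affine (D : Vir K -> vpoly (Vir K)) : GDer (Vir K) D ->
  exists a0 a1 : {poly K},
    D (Vir_L K) = affine a0 a1 *: vconst (Vir_L K).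
Proof.
move=> [gD [D' [D'' [gD' gD'' eqD]]]].
have := (gder_symbolP _ _ _ _ _ _ gD (vpoly_rank1 _) gD' (vpoly_rank1 _)
  gD'' (vpoly_rank1 _)).1 eqD.
move=> /gder_symbol_affine[a0 [a1 eqF]]; exists a0, a1.
by rewrite -eqF -vpoly_rank1.
Qed.

Lemma affine_QDer_Vir (D : Vir K -> vpoly (Vir K)) (a0 a1 : {poly K}) :
  gc (Vir K) D ->
  D (Vir_L K) = affine a0 a1 *: vconst (Vir_L K) ->
  QDer (Vir K) D.
Proof.
move=> gD DL; split=> //.
have [D' [[gD' DL'] _]] := gc_Vir_determined
  (affine (a0 + a0 - ('X + 'X) * a1) a1).
exists D' => //.
exact/(gder_symbolP _ _ _ _ _ _ gD DL gD DL gD' DL')/affine_gder_symbol.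
Qed.

(** The quasicentroid identity is the equation for symbols with G = - F and
H = 0. *)
Lemma quasicentroid_Vir0 (D : Vir K -> vpoly (Vir K)) :
  quasicentroid (Vir K) D -> D = (fun=> 0).
Proof.
move=> [gD eqD]; have DL := vpoly_rank1 (D (Vir_L K)).
set F := vcoord _ in DL.
have sym : gder_symbol F (- F) 0.
  have := eqD (Vir_L K) (Vir_L K).
  rewrite (bracketDlE _ _ gD DL) (bracketDrE _ _ gD DL) weightLL !mul1r.
  by move=> /Vir_E_inj eqF; rewrite /gder_symbol eqF eval23N eval23_0 mulr0 mulNr subrr.
have F0 : F = 0.
  have /eqP := gder_symbol_eq _ _ _ sym.
  rewrite -addr_eq0 -mulr2n -mulr_natl mulf_eq0 -!polyC_natr !polyC_eq0.
  by rewrite ((pcharf0P K).1 charK) => /eqP.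
by apply: funext => a; rewrite (gc_VirE _ _ gD DL) F0 mulr0 scale0r.
Qed.

Lemma centroid_Vir0 : centroid (Vir K) (fun=> 0).
Proof.
have g0 := gc0 _ (Vir K).
have D0 : (fun=> 0) (Vir_L K) = 0 *: vconst (Vir_L K) by rewrite scale0r.
split; first exact: g0.
move=> a b; rewrite (bracketDlE _ _ g0 D0) (bracketDrE _ _ g0 D0) (mapbracketE _ _ g0 D0).
by rewrite !eval23_0 !(mul0r, mulr0).
Qed.

End Virasoro.

Theorem proposition3p1 (R : realType) :
  [/\ GDer (Vir R[i]) = QDer (Vir R[i]),
      QDer (Vir R[i]) =
        [set D | gc (Vir R[i]) D /\
           exists a0 a1 : {poly R[i]},
             D (Vir_L R[i]) = (a0^:P + a1^:P * 'X%:P) *: vconst (Vir_L R[i])],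
      centroid (Vir R[i]) = quasicentroid (Vir R[i]) &
      quasicentroid (Vir R[i]) = [set (fun _ => 0)]].
Proof.
have char0 : [pchar R[i]] =i pred0 by exact: Num.Theory.pchar_num.
have GQ (D : Vir R[i] -> vpoly (Vir R[i])) :
    GDer (Vir R[i]) D -> QDer (Vir R[i]) D.
  move=> gdD; have [a0 [a1 DL]] := GDer_Vir_affine _ char0 _ gdD.
  by apply: affine_QDer_Vir DL; case: gdD.
split; apply/seteqP; split=> D /=.
- exact: GQ.
- exact: QDer_sub_GDer.
- move=> qD; split; first by case: qD.
  exact/(GDer_Vir_affine _ char0)/QDer_sub_GDer.
- by move=> [gD [a0 [a1 DL]]]; exact: affine_QDer_Vir DL.
- exact: centroid_sub_quasicentroid.
- by move=> /(quasicentroid_Vir0 _ char0) ->; exact: centroid_Vir0.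
- exact: quasicentroid_Vir0.
- by move=> ->; exact/centroid_sub_quasicentroid/centroid_Vir0.
Qed.
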